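(* Let $A,B\in\mathbb{R}_{\max}^{m\times n}$ have no rows identically equal to $-\infty$ and no common column identically equal to $-\infty$. Then $$\mathrm{spec}(A,B)\subseteq\bigcup_{1\le i\le n}[-(A^{\sharp}B0)_i,\,(B^{\sharp}A0)_i],$$ and so $$\mathrm{spec}(A,B)\subseteq\Big[-\max_i(A^{\sharp}B0)_i,\ \max_i(B^{\sharp}A0)_i\Big],$$ where $0$ is the $n$-vector of all zeros.
   Context: $\mathbb{R}_{\max}=\mathbb{R}\cup\{-\infty\}$. For $A=(a_{ij})\in\mathbb{R}_{\max}^{m\times n}$ and $x\in\mathbb{R}_{\max}^n$, $(Ax)_i=\max_j(a_{ij}+x_j)$. For $y\in\mathbb{R}_{\max}^m$, $(A^{\sharp}y)_j=\min_{1\le i\le m}(-a_{ij}+y_i)$ with $(-\infty)+(+\infty)=+\infty$ (so the value is $+\infty$ if column $j$ of $A$ is identically $-\infty$); $A^{\sharp}B0$ means $A^{\sharp}(B0)$. $\mathrm{spec}(A,B)$ is the set of finite $\lambda\in\mathbb{R}$ for which $Ax=\lambda+Bx$ for some $x\in\mathbb{R}_{\max}^n$ with at least one component not equal to $-\infty$. An interval $[a,b]$ may have infinite endpoints and is empty if $a>b$. *)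

(* Defs.v *)
(* MathComp world (with the extended reals of MathComp-Analysis). *)
From mathcomp Require Import all_boot all_order all_algebra.
From mathcomp Require Import all_classical all_reals.

Set Implicit Arguments.
Unset Strict Implicit.
Unset Printing Implicit Defensive.

Local Open Scope classical_set_scope.
Local Open Scope ring_scope.
Local Open Scope ereal_scope.

(* R_max = R U {-oo}, as a predicate on the extended reals; matrices and
   vectors over R_max are the elements of [mxOver Rmax]. *)
Definition Rmax {R : realType} : {pred \bar R} := [pred x | x != +oo].

(* On R_max the addition %E is the max-plus one: (-oo) + x = -oo. *)
Definition maxplus_mul {R : realType} {m n : nat}
    (A : 'M[\bar R]_(m, n)) (x : 'cV[\bar R]_n) : 'cV[\bar R]_m :=
  \col_(i < m) \big[maxe/-oo]_(j < n) (A i j + x j ord0).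

(* The residual A^# y. The addition %dE is the dual one, for which
   (-oo) + (+oo) = +oo; hence the value is +oo on a column of A that is
   identically -oo. *)
Definition maxplus_sharp {R : realType} {m n : nat}
    (A : 'M[\bar R]_(m, n)) (y : 'cV[\bar R]_m) : 'cV[\bar R]_n :=
  \col_(j < n) \big[mine/+oo]_(i < m) (- A i j + y i ord0)%dE.

Definition spec {R : realType} {m n : nat} (A B : 'M[\bar R]_(m, n)) : set R :=
  [set lambda | exists x : 'cV[\bar R]_n,
     [/\ x \is a mxOver Rmax,
         exists j, x j ord0 != -oo &
         forall i, maxplus_mul A x i ord0
                   = lambda%:E + maxplus_mul B x i ord0]].

Definition vec0 {R : realType} {n : nat} : 'cV[\bar R]_n := const_mx 0.

(* Main.v *)
(* If x solves A x = lambda + B x and x_j is a maximal entry of x, then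
   a_ij + x_j <= lambda + (B x)_i <= lambda + (B 0)_i + x_j for every i, so that
   -lambda <= (A^# B 0)_j; exchanging A and B gives lambda <= (B^# A 0)_j. *)
Require Import Defs.
From mathcomp Require Import all_boot all_order all_algebra.
From mathcomp Require Import all_classical all_reals.
From mathcomp Require Import lra.

Import Order.TTheory GRing.Theory Num.Theory.

Local Open Scope classical_set_scope.
Local Open Scope ring_scope.
Local Open Scope ereal_scope.

Lemma le_maxplus_mul_vec0 (R : realType) (m n : nat) (B : 'M[\bar R]_(m, n))
    (x : 'cV[\bar R]_n) (r : R) (i : 'I_m) :
  (forall j, x j ord0 <= r%:E) ->
  maxplus_mul B x i ord0 <= maxplus_mul B vec0 i ord0 + r%:E.
Proof.
move=> xr; rewrite !mxE; apply/bigmax_leP; split => [|j _]; first exact: leNye.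
by apply: leeD => //; apply: le_trans (le_bigmax _ _ j); rewrite mxE adde0.
Qed.

(** Only the inequality between the two sides is assumed, so this serves both endpoints: once for
    [A], [B], [l] and once for [B], [A], [- l]. Finiteness of the maximal entry [r] lets it be
    cancelled. *)
Lemma le_maxplus_sharp (R : realType) (m n : nat) (A B : 'M[\bar R]_(m, n))
    (x : 'cV[\bar R]_n) (l r : R) (j : 'I_n) :
  A \is a mxOver Rmax -> x j ord0 = r%:E ->
  (forall k, x k ord0 <= x j ord0) ->
  (forall i, maxplus_mul A x i ord0 <= l%:E + maxplus_mul B x i ord0) ->
  - l%:E <= maxplus_sharp A (maxplus_mul B vec0) j ord0.
Proof.
move=> /mxOverP AR xj xmax AxB; rewrite mxE.
apply/bigmin_geP; split => [|i _]; first exact: leey.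
have : A i j + r%:E <= l%:E + (maxplus_mul B vec0 i ord0 + r%:E).
  apply: (@le_trans _ _ (maxplus_mul A x i ord0)).
    by rewrite mxE -xj (le_bigmax _ (fun k => A i k + x k ord0)).
  apply: le_trans (AxB i) _; rewrite leeD2l// le_maxplus_mul_vec0// => k.
  by rewrite -xj.
(* If [A i j] is [-oo], the dual sum is [+oo]; if [A i j] is finite and the entry of [B 0] is [-oo],
   the inequality just proved fails. Only finite entries leave arithmetic to do. *)
move: (AR i j); rewrite inE.
case: (A i j) => [a| |] // _; case: (maxplus_mul B vec0 i ord0) => [b| |] //=;
  rewrite ?leey //.
by rewrite DualAddTheoryNumDomain.dual_addeE_def// -!EFinD !lee_fin; lra.
Qed.

Theorem proposition7 (R : realType) (m n : nat) (A B : 'M[\bar R]_(m, n))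
    (AR : A \is a mxOver Rmax) (BR : B \is a mxOver Rmax)
    (rowA : forall i, exists j, A i j != -oo)
    (rowB : forall i, exists j, B i j != -oo)
    (colAB : ~ exists j, forall i, A i j = -oo /\ B i j = -oo) :
  let AsB0 := maxplus_sharp A (maxplus_mul B vec0) in
  let BsA0 := maxplus_sharp B (maxplus_mul A vec0) in
  EFin @` spec A B `<=`
    \bigcup_(i : 'I_n) `[- AsB0 i ord0, BsA0 i ord0]%classic
  /\
  EFin @` spec A B `<=`
    `[- (\big[maxe/-oo]_(i < n) AsB0 i ord0),
      \big[maxe/-oo]_(i < n) BsA0 i ord0]%classic.
Proof.
move=> AsB0 BsA0.
have sub : EFin @` spec A B `<=`
    \bigcup_(i : 'I_n) `[- AsB0 i ord0, BsA0 i ord0]%classic.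
  move=> _ [l [x [/mxOverP xR [j0 xj0] AxB]] <-].
  have [j _ xmax] := @arg_maxP _ _ _ j0 predT (fun k => x k ord0) isT.
  have {}xmax k : x k ord0 <= x j ord0 by exact: xmax.
  (* The maximal entry is finite: membership in [Rmax] excludes [+oo], and dominating the entry at
     [j0] excludes [-oo]. *)
  have xj : x j ord0 = (fine (x j ord0))%:E.
    move: (xR j ord0) (xmax j0); rewrite inE.
    by case: (x j ord0) => [r| |] //= _; rewrite leeNy_eq (negbTE xj0).
  exists j => //=; rewrite in_itv /=; apply/andP; split.
    by rewrite leeNl (le_maxplus_sharp _ _ _ _ _ x _ _ _ _ xj)// => i; rewrite AxB.
  (* Since [l] is finite, the equation can be read as [B x = - l + A x], with the same index [j]. *)
  rewrite -[l%:E]oppeK -EFinN (le_maxplus_sharp _ _ _ _ _ x _ _ _ _ xj)// => i.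
  by rewrite AxB addeA// -EFinD addNr add0e.
(* Each interval of the union lies in the one bounded by the two maxima. *)
split=> // y /sub[j _] /=; rewrite !in_itv /= => /andP[lo hi]; apply/andP; split.
  by apply: le_trans lo; rewrite leeN2 (le_bigmax _ (fun i => AsB0 i ord0)).
by apply: le_trans hi _; rewrite (le_bigmax _ (fun i => BsA0 i ord0)).
Qed.
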